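(* Let $W$ be a finite Coxeter group of simply-laced type. Then for any $u, w \in W$, we have $\Phi_{u \vee w} = \overline{\Phi_u \cup \Phi_w}^{\mathrm{br}}$, where $u\vee w$ is the join in the right weak order and $\overline{\,\cdot\,}^{\mathrm{br}}$ is the Bruhat preclosure.
   Context: Let $(W,S)$ be a Coxeter system with Coxeter matrix $(m(s,t))_{s,t\in S}$ and length function $\ell$. It is simply-laced if $m(s,t)\in\{2,3\}$ for all $s\neq t$ in $S$. Let $\Phi$ be the root system of $(W,S)$ (in the standard geometric representation), $\Phi^+$ the set of positive roots with respect to $S$, $\Phi^-=-\Phi^+$. For $\alpha\in\Phi$, $s_\alpha\in W$ denotes the reflection in $\alpha$. For $w \in W$ the inversion set is $\Phi_w = \Phi^+ \cap w(\Phi^-)$. The (right) weak order on $W$ is defined by $u \le w$ if and only if $\Phi_u \subseteq \Phi_w$. When $W$ is finite it is a lattice, and $u\vee w$ denotes the join of $u$ and $w$. For $A\subseteq\Phi^+$, the Bruhat preclosure $\overline{A}^{\mathrm{br}}$ is the set of those $\alpha \in \Phi^+$ for which there exist $\alpha_1, \ldots, \alpha_m \in A$ such that $s_\alpha = s_{\alpha_1} \cdots s_{\alpha_m}$ and $0 < \ell(s_{\alpha_1}) < \ell(s_{\alpha_1} s_{\alpha_2}) < \cdots < \ell(s_{\alpha_1} s_{\alpha_2} \cdots s_{\alpha_m})$. *)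

(* Defs.v *)
From HB Require Import structures.
From mathcomp Require Import all_boot all_order all_algebra all_fingroup.
From mathcomp Require Import classical_sets reals topology normedtype trigo.

Set Implicit Arguments.
Unset Strict Implicit.
Unset Printing Implicit Defensive.

Import Order.TTheory GRing.Theory Num.Theory.

Local Open Scope group_scope.
Local Open Scope classical_set_scope.
Local Open Scope ring_scope.

(* Entry 0 encodes m(s,t) = oo. *)
Definition coxeter_matrix (n : nat) (m : 'M[nat]_n) : Prop :=
  [/\ forall i, m i i = 1%N,
      forall i j, m i j = m j i
    & forall i j, i != j -> m i j != 1%N].

(* A Coxeter system (W, S) with S = {s_i | i < n}.  The last two fields say
   that W is presented by < s_i | (s_i s_j) ^ m(i,j) = 1 >: the s_i generate W
   and satisfy the relations, and any other solution of the relations in a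
   group G is the image of the s_i under a homomorphism W -> G.  Generation is
   by words without inverses, since s_i ^ 2 = 1.  For m(i,j) = oo the relation
   reads x ^ 0 = 1 and is void. *)
Record coxeterSystem (n : nat) (W : groupType) := CoxeterSystem {
  cox_mx : 'M[nat]_n;
  cox_gen : 'I_n -> W;
  cox_mxP : coxeter_matrix cox_mx;
  cox_relP : forall i j, ((cox_gen i * cox_gen j) ^+ cox_mx i j = 1)%g;
  cox_genP : forall w : W,
    exists ws : seq 'I_n, (\prod_(i <- ws) cox_gen i)%g == w;
  cox_univP : forall (G : groupType) (f : 'I_n -> G),
    (forall i j, ((f i * f j) ^+ cox_mx i j = 1)%g) ->
    exists phi : {multiplicative W -> G}, forall i, phi (cox_gen i) = f i
}.

Definition simply_laced (n : nat) (W : groupType) (C : coxeterSystem n W) :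
    Prop :=
  forall i j : 'I_n, i != j -> cox_mx C i j = 2%N \/ cox_mx C i j = 3%N.

Section Length.
Variables (n : nat) (W : groupType) (C : coxeterSystem n W).

Definition has_word_of_size (w : W) (k : nat) : bool :=
  [exists ws : k.-tuple 'I_n, (\prod_(i <- ws) cox_gen C i)%g == w].

Lemma has_word_ex (w : W) : exists k, has_word_of_size w k.
Proof.
have [ws wsP] := cox_genP C w.
by exists (size ws); apply/existsP; exists (in_tuple ws).
Qed.

Definition cox_length (w : W) : nat := ex_minn (has_word_ex w).

End Length.

Section GeometricRepresentation.
Variables (R : realType) (n : nat) (W : groupType) (C : coxeterSystem n W).

Definition simple_root (i : 'I_n) : 'rV[R]_n := delta_mx 0 i.

(* In the case m(i,j) = oo (entry 0), pi / 0 = 0 and the value is -1, which is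
   the usual convention. *)
Definition cox_form (v w : 'rV[R]_n) : R :=
  \sum_i \sum_j v 0 i * w 0 j * - cos (pi / (cox_mx C i j)%:R).

Definition refl (a v : 'rV[R]_n) : 'rV[R]_n := v - (2 * cox_form v a) *: a.

Definition word_action (ws : seq 'I_n) (v : 'rV[R]_n) : 'rV[R]_n :=
  foldr (fun i => refl (simple_root i)) v ws.

(* The choice of the word is irrelevant: the reflections in the simple roots
   satisfy the defining relations of W. *)
Definition geom_rep (w : W) : 'rV[R]_n -> 'rV[R]_n :=
  word_action (xchoose (cox_genP C w)).

Definition roots : set 'rV[R]_n :=
  [set a | exists w i, a = geom_rep w (simple_root i)].

Definition pos_roots : set 'rV[R]_n :=
  [set a | roots a /\ forall i, 0 <= a 0 i].

Definition neg_roots : set 'rV[R]_n := -%R @` pos_roots.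

(* For a root a = w(alpha_i) this is w s_i w^-1, the only element of W acting
   as the reflection in a.  The value at a non-root is irrelevant. *)
Definition root_refl (a : 'rV[R]_n) : W :=
  xget 1%g [set t | geom_rep t =1 refl a].

Definition inversion_set (w : W) : set 'rV[R]_n :=
  pos_roots `&` geom_rep w @` neg_roots.

Definition weak_le (u w : W) : Prop := inversion_set u `<=` inversion_set w.

Definition is_weak_join (u w v : W) : Prop :=
  [/\ weak_le u v, weak_le w v
    & forall z, weak_le u z -> weak_le w z -> weak_le v z].

(* Meaningful when the join exists, in particular when W is finite. *)
Definition weak_join (u w : W) : W := xget 1%g [set v | is_weak_join u w v].

Definition refl_prod (as_ : seq 'rV[R]_n) : W :=
  (\prod_(a <- as_) root_refl a)%g.

(* The inequality for k = 0 is 0 < l(s_{a_1}). *)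
Definition bruhat_preclosure (A : set 'rV[R]_n) : set 'rV[R]_n :=
  [set a | pos_roots a /\
    exists as_ : seq 'rV[R]_n,
      [/\ forall b, b \in as_ -> A b,
          root_refl a = refl_prod as_
        & forall k, (k < size as_)%N ->
            (cox_length C (refl_prod (take k as_)) <
             cox_length C (refl_prod (take k.+1 as_)))%N]].

End GeometricRepresentation.

Arguments inversion_set R {n W} C w.
Arguments weak_le R {n W} C u w.
Arguments is_weak_join R {n W} C u w v.
Arguments weak_join R {n W} C u w.

(* Main.v *)
(* Write (a, b) for twice the form, so that roots have norm 2, and let A be the
   union of the inversion sets of u and w.

   Any positive root a that is a sum of elements of A lies in the Bruhat
   preclosure of A, for an arbitrary set A of positive roots.  Some summand c has
   (c, a) > 0.  If c <> a then (c, a) = 1 and b := a - c = s_c a is again such a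
   root, with fewer summands, so s_a = s_c s_b s_c, and inductively s_b has an
   increasing path x_0 = 1, x_1, ... with labels in A.  The path is required to
   satisfy (x_k b_k, b) > 0 for each label b_k; this is what makes
   s_c x_0, s_c x_1, ... increasing too, because (d, b) >= 1 and (d, c) >= 1 force
   (d - c, b) >= 2, hence d - c = b.

   Conversely, along a path with labels in the inversion set of v the lengths of
   the x_k v decrease, so the preclosure of A is contained in every inversion set
   that contains A.  It remains to find v whose inversion set contains A and
   consists of sums of elements of A; such a v is then the join. *)

From HB Require Import structures.
From mathcomp Require Import all_boot all_order all_algebra all_fingroup.
From mathcomp Require Import boolp classical_sets reals trigo.
From mathcomp Require Import ring lra zify.
Require Import Defs.

Set Implicit Arguments.
Unset Strict Implicit.
Unset Printing Implicit Defensive.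

Import Order.TTheory GRing.Theory Num.Theory.

Local Open Scope group_scope.
Local Open Scope classical_set_scope.
Local Open Scope ring_scope.

(** The triple-angle formula at [pi / 3] makes [c] a root of 4c^3 - 3c + 1 = (c + 1)(2c - 1)^2, and
    [c > 0] excludes the root -1. *)
Lemma cos_pi_third (R : realType) : cos (pi / 3) = 2^-1 :> R.
Proof.
set c := cos _.
have c_gt0 : 0 < c.
  by apply: cos_gt0_pihalf; have := pi_gt0 R; lra.
have := cospi R; have -> : pi = pi / 3 + (pi / 3 + pi / 3) :> R by field.
rewrite !(cosD, sinD) -/c; have := cos2Dsin2 (pi / 3 : R); rewrite -/c.
set s := sin _ => cs e.
have : (c + 1) * (2 * c - 1) ^+ 2 = 0.
  have {}cs : s ^+ 2 = 1 - c ^+ 2 by rewrite -cs; ring.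
  have : c ^+ 3 - 3 * c * s ^+ 2 = -1 by rewrite -e; ring.
  by rewrite cs => {}e; lra.
by move/eqP; rewrite mulf_eq0 sqrf_eq0 => /orP[] /eqP; lra.
Qed.

(** * The geometric representation *)

Section UnitMatrices.
Variables (R : comUnitRingType) (n : nat).

(** The general linear group in every dimension, [n = 0] included, as a target for [cox_univP]. *)
Definition unit_mx := {A : 'M[R]_n | A \in unitmx}.
HB.instance Definition _ := Choice.on unit_mx.
HB.instance Definition _ := SubType.on unit_mx.

Implicit Types x y z : unit_mx.
Definition umx1 : unit_mx := Sub 1%:M (unitmx1 R n).
Fact umxM_unit x y : val x *m val y \in unitmx.
Proof. by rewrite unitmx_mul (valP x) (valP y). Qed.
Definition umxM x y : unit_mx := Sub (val x *m val y) (umxM_unit x y).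
Fact umxV_unit x : invmx (val x) \in unitmx.
Proof. by rewrite unitmx_inv (valP x). Qed.
Definition umxV x : unit_mx := Sub (invmx (val x)) (umxV_unit x).

Fact umxMA : associative umxM.
Proof. by move=> x y z; apply: val_inj; rewrite /= mulmxA. Qed.
Fact umx1M : left_id umx1 umxM.
Proof. by move=> x; apply: val_inj; rewrite /= mul1mx. Qed.
Fact umxM1 : right_id umx1 umxM.
Proof. by move=> x; apply: val_inj; rewrite /= mulmx1. Qed.
Fact umxVM : left_inverse umx1 umxV umxM.
Proof. by move=> x; apply: val_inj; rewrite /= mulVmx ?(valP x). Qed.
Fact umxMV : right_inverse umx1 umxV umxM.
Proof. by move=> x; apply: val_inj; rewrite /= mulmxV ?(valP x). Qed.

HB.instance Definition _ :=
  isGroup.Build unit_mx umxMA umx1M umxM1 umxVM umxMV.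

Lemma unit_mx_eq1 x : (forall v : 'rV_n, v *m val x = v) -> x = 1%g.
Proof.
by move=> xv; apply/val_inj/row_matrixP => i; rewrite !rowE xv mulmx1.
Qed.

End UnitMatrices.

Section Form.
Variables (R : realType) (n : nat) (W : groupType) (C : coxeterSystem n W).
Implicit Types (a b v w : 'rV[R]_n) (i j k : 'I_n).

(** With the factor 2, the reflection in [a] is [v - ip v a *: a], and in the simply-laced case all
    pairings of roots are integers. *)
Definition ip v w : R := 2 * cox_form C v w.

Lemma ipC v w : ip v w = ip w v.
Proof.
rewrite /ip /cox_form exchange_big /=; congr (_ * _).
apply: eq_bigr => i _; apply: eq_bigr => j _.
by case: (cox_mxP C) => _ mC _; rewrite mC; ring.
Qed.

Lemma ip_linear w c u v : ip (c *: u + v) w = c * ip u w + ip v w.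
Proof.
rewrite /ip /cox_form !mulr_sumr -big_split /=.
apply: eq_bigr => i _; rewrite mulrCA -mulrDr; congr (_ * _).
rewrite mulr_sumr -big_split /=; apply: eq_bigr => j _.
by rewrite !mxE; ring.
Qed.

Lemma ipDl u v w : ip (u + v) w = ip u w + ip v w.
Proof. by rewrite -[u]scale1r ip_linear scale1r mul1r. Qed.
Lemma ipDr u v w : ip w (u + v) = ip w u + ip w v.
Proof. by rewrite ipC ipDl !(ipC w). Qed.
Lemma ip0l w : ip 0 w = 0.
Proof. by apply: (addrI (ip 0 w)); rewrite -ipDl !addr0. Qed.
Lemma ipZl c v w : ip (c *: v) w = c * ip v w.
Proof. by rewrite -[c *: v]addr0 ip_linear ip0l addr0. Qed.
Lemma ipZr c v w : ip w (c *: v) = c * ip w v.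
Proof. by rewrite ipC ipZl ipC. Qed.
Lemma ipNl v w : ip (- v) w = - ip v w.
Proof. by rewrite -scaleN1r ipZl mulN1r. Qed.
Lemma ipNr v w : ip w (- v) = - ip w v.
Proof. by rewrite ipC ipNl ipC. Qed.
Lemma ip_suml I (r : seq I) (F : I -> 'rV[R]_n) w :
  ip (\sum_(x <- r) F x) w = \sum_(x <- r) ip (F x) w.
Proof. by apply: (big_morph (ip^~ w)) => [u v|]; rewrite ?ipDl ?ip0l. Qed.

Definition ipE := (ipDl, ipDr, ipNl, ipNr, ipZl, ipZr).

Lemma reflE a v : refl C a v = v - ip v a *: a.
Proof. by []. Qed.

Lemma refl_linear_proof a : linear (refl C a).
Proof.
move=> c u v; rewrite !reflE !ipE scalerDl scalerBr !scalerA.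
by rewrite opprD addrACA.
Qed.
HB.instance Definition _ a :=
  GRing.isLinear.Build R 'rV[R]_n 'rV[R]_n *:%R (refl C a) (refl_linear_proof a).

Lemma refl_self a : ip a a = 2 -> refl C a a = - a.
Proof. by move=> aa; rewrite reflE aa scaler_nat mulr2n opprD addNKr. Qed.

Lemma reflN a : refl C (- a) =1 refl C a.
Proof. by move=> v; rewrite !reflE !ipE scalerN scaleNr opprK. Qed.

Lemma reflK a : ip a a = 2 -> involutive (refl C a).
Proof.
move=> aa v.
by rewrite [X in refl C a X]reflE linearB linearZ /= refl_self// reflE scalerN
  opprK subrK.
Qed.

Lemma refl_isom a v w : ip a a = 2 -> ip (refl C a v) (refl C a w) = ip v w.
Proof. by move=> aa; rewrite !reflE !ipE aa (ipC a w); ring. Qed.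

Lemma simple_root_ip i j :
  ip (simple_root R i) (simple_root R j) = - 2 * cos (pi / (cox_mx C i j)%:R).
Proof.
rewrite /ip /cox_form (bigD1 i)//= (bigD1 j)//=.
rewrite !big1 => [|k ki|k kj]; last first.
- by rewrite /simple_root !mxE eqxx (negPf kj) mulr0 mul0r.
- by apply: big1 => l _; rewrite /simple_root !mxE (negPf ki) andbF !mul0r.
by rewrite /simple_root !mxE !eqxx /=; ring.
Qed.

Lemma simple_root_norm i : ip (simple_root R i) (simple_root R i) = 2.
Proof.
by rewrite simple_root_ip; case: (cox_mxP C) => -> _ _; rewrite divr1 cospi; ring.
Qed.

Lemma row_sum_simple v : v = \sum_i v 0 i *: simple_root R i.
Proof. exact: row_sum_delta. Qed.

Lemma word_action_linear_proof ws : linear (word_action C ws : 'rV[R]_n -> _).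
Proof. by elim: ws => [|i ws IH] c u v //=; rewrite IH linearP. Qed.
HB.instance Definition _ ws :=
  GRing.isLinear.Build R 'rV[R]_n 'rV[R]_n *:%R (word_action C ws)
    (word_action_linear_proof ws).
HB.instance Definition _ (w : W) :=
  GRing.Linear.copy (geom_rep C w : 'rV[R]_n -> 'rV[R]_n)
     (word_action C (xchoose (cox_genP C w))).

Lemma word_action_isom ws v w : ip (word_action C ws v) (word_action C ws w) = ip v w.
Proof. by elim: ws => //= i ws IH; rewrite refl_isom ?IH// simple_root_norm. Qed.

Lemma geom_rep_isom (x : W) v w : ip (geom_rep C x v) (geom_rep C x w) = ip v w.
Proof. exact: word_action_isom. Qed.

Lemma cox_gen2 i : (cox_gen C i * cox_gen C i = 1)%g.
Proof. by have := cox_relP C i i; case: (cox_mxP C) => -> _ _; rewrite expg1. Qed.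

Lemma cox_genV i : ((cox_gen C i)^-1 = cox_gen C i)%g.
Proof. by rewrite -[LHS]mulg1 -(cox_gen2 i) mulKg. Qed.

End Form.

(** * Length and positivity of roots *)

Section Length.
Variables (n : nat) (W : groupType) (C : coxeterSystem n W).
Implicit Types (w : W) (ws : seq 'I_n) (i : 'I_n).

Definition word_prod ws : W := (\prod_(i <- ws) cox_gen C i)%g.

Lemma word_prod_cat ws1 ws2 :
  word_prod (ws1 ++ ws2) = (word_prod ws1 * word_prod ws2)%g.
Proof. by rewrite /word_prod big_cat. Qed.

Lemma cox_length_le ws : (cox_length C (word_prod ws) <= size ws)%N.
Proof.
rewrite /cox_length; case: ex_minnP => k _; apply.
by apply/existsP; exists (in_tuple ws).
Qed.

Lemma cox_length_word w : exists2 ws, word_prod ws = w & size ws = cox_length C w.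
Proof.
rewrite /cox_length; case: ex_minnP => k /existsP[ws /eqP wsw] _.
by exists ws; rewrite ?size_tuple.
Qed.

(** This is the sign character: sending every generator to the transposition of ['S_2] respects the
    relations, since any product of two images is trivial. *)
Lemma cox_parity : exists h : W -> bool, forall ws, h (word_prod ws) = odd (size ws).
Proof.
pose t : 'S_2 := tperm 0 1.
have [|phi phiE] := @cox_univP _ _ C 'S_2 (fun=> t).
  by move=> i j; rewrite tperm2 expg1n.
have phi1 : phi 1%g = 1%g by apply: (mulgI (phi 1%g)); rewrite -gmulfM !mulg1.
exists (fun w => odd_perm (phi w)); elim=> [|i ws IH].
  by rewrite /word_prod big_nil phi1 odd_perm1.
by rewrite /word_prod big_cons gmulfM odd_permM phiE IH odd_tperm.
Qed.

(** The two lengths differ by at most one, and parity rules out equality. *)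
Lemma cox_length_gen w i :
  cox_length C (w * cox_gen C i)%g = (cox_length C w).+1 \/
  cox_length C w = (cox_length C (w * cox_gen C i)%g).+1.
Proof.
have le x : (cox_length C (x * cox_gen C i)%g <= (cox_length C x).+1)%N.
  have [ws <- <-] := cox_length_word x.
  have := cox_length_le (rcons ws i).
  by rewrite /word_prod big_rcons size_rcons.
have := le (w * cox_gen C i)%g; rewrite -mulgA cox_gen2 mulg1.
have := le w; have [h hE] := cox_parity.
have [ws wsE <-] := cox_length_word w.
have [ws' ws'E <-] := cox_length_word (w * cox_gen C i)%g.
have : odd (size ws') = ~~ odd (size ws).
  by rewrite -hE ws'E -wsE -[LHS]/(h (word_prod ws * _)%g) /word_prod -big_rcons hE
    size_rcons.
lia.
Qed.

End Length.

Section SimplyLaced.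
Variables (R : realType) (n : nat) (W : groupType) (C : coxeterSystem n W).
Hypothesis sl : simply_laced C.
Implicit Types (a b v : 'rV[R]_n) (i j k : 'I_n) (x y w : W).

Local Notation ip := (ip C).
Local Notation alpha := (simple_root R).
Local Notation s i := (cox_gen C i).
Local Notation rep := (@geom_rep R n W C).
Local Notation len := (cox_length C).

Variant simple_pair_spec i j : Prop :=
| SimplePairEq of i = j
| SimplePair2 of i != j & ip (alpha i) (alpha j) = 0
    & (s i * s j = s j * s i)%g
| SimplePair3 of i != j & ip (alpha i) (alpha j) = - 1
    & (s i * s j * s i = s j * s i * s j)%g.

Lemma simple_pairP i j : simple_pair_spec i j.
Proof.
case: (eqVneq i j) => [<-|ij]; first by constructor.
have := simple_root_ip R C i j; have := cox_relP C i j.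
have inv x y : (x * y = 1 -> x = y^-1)%g by
  move=> xy; rewrite -[(y^-1)%g]mul1g -xy mulgK.
case: (sl ij) => ->.
  rewrite cos_pihalf mulr0 => e ij0; apply: SimplePair2 => //.
  by move: e; rewrite expgS expg1 => /inv; rewrite invgM !cox_genV.
rewrite cos_pi_third mulNr divff ?pnatr_eq0// => e ij1; apply: SimplePair3 => //.
have {}e : ((s i * s j * s i) * (s j * s i * s j) = 1)%g.
  by rewrite -e !expgS expg0 mulg1 !mulgA.
by rewrite (inv _ _ e) !invgM !cox_genV !mulgA.
Qed.

Lemma refl_commute a b v : ip a b = 0 ->
  refl C a (refl C b v) = refl C b (refl C a v).
Proof.
move=> ab; rewrite !reflE !ipE (ipC _ b) ab.
by apply/rowP => i; rewrite !mxE; ring.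
Qed.

Lemma refl_braid a b v : ip a a = 2 -> ip b b = 2 -> ip a b = - 1 ->
  refl C a (refl C b (refl C a v)) = refl C b (refl C a (refl C b v)).
Proof.
move=> aa bb ab; rewrite !reflE !ipE (ipC _ b a) aa bb ab; apply/rowP => i.
by rewrite !mxE; ring.
Qed.

(** Makes the action of a word depend only on its product, since the simple reflections satisfy the
    defining relations. Matrices act on row vectors from the right, and the inverse turns this into
    a left action. *)
Lemma word_action_mx : exists phi : {multiplicative W -> unit_mx R n},
  forall ws v, word_action C ws v = v *m val (phi (word_prod C ws)^-1)%g.
Proof.
pose M i := lin1_mx (refl C (alpha i)).
have ME i v : v *m M i = refl C (alpha i) v by rewrite mul_rV_lin1.
have MM i : M i *m M i = 1%:M.
  by apply/row_matrixP => j; rewrite !rowE mulmxA !ME reflK ?simple_root_norm ?mulmx1.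
have Mu i : M i \in unitmx by apply: (mulmx1_unit (MM i)).1.
pose f i : unit_mx R n := Sub (M i) (Mu i).
have fE i v : v *m val (f i) = refl C (alpha i) v by rewrite SubK.
have fM (g h : unit_mx R n) v : v *m val (g * h)%g = v *m val g *m val h.
  by rewrite -mulmxA.
have frel i j : ((f i * f j) ^+ cox_mx C i j = 1)%g.
  apply: unit_mx_eq1 => v.
  have [<-|ij] := eqVneq i j.
    by case: (cox_mxP C) => -> _ _; rewrite expg1 fM !fE reflK ?simple_root_norm.
  have := simple_root_ip R C i j.
  have ri := reflK (simple_root_norm R C i).
  have rj := reflK (simple_root_norm R C j).
  case: (sl ij) => ->; rewrite !expgS expg0 mulg1 ?fM !fE.
    by rewrite cos_pihalf mulr0 => /refl_commute ->; rewrite rj ri.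
  rewrite cos_pi_third mulNr divff ?pnatr_eq0// => /refl_braid <-;
    rewrite ?simple_root_norm//.
  by rewrite !(ri, rj).
have [phi phiE] := cox_univP frel.
have phi1 : phi 1%g = 1%g by apply: (mulgI (phi 1%g)); rewrite -gmulfM !mulg1.
exists phi; elim=> [|i ws IH] v.
  by rewrite /word_prod big_nil invg1 phi1 mulmx1.
by rewrite /= IH /word_prod big_cons invgM cox_genV gmulfM phiE fM fE.
Qed.

Lemma geom_rep_word ws : rep (word_prod C ws) =1 word_action C ws.
Proof.
move=> v; have [phi phiE] := word_action_mx; rewrite /geom_rep !phiE.
by have /eqP := xchooseP (cox_genP C (word_prod C ws)); rewrite /word_prod => ->.
Qed.

Lemma geom_repM x y v : rep (x * y)%g v = rep x (rep y v).
Proof.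
have [ws <- _] := cox_length_word C x; have [ws' <- _] := cox_length_word C y.
by rewrite -word_prod_cat !geom_rep_word /word_action foldr_cat.
Qed.

Lemma geom_rep1 v : rep 1%g v = v.
Proof. by have := geom_rep_word [::] v; rewrite /word_prod big_nil. Qed.

Lemma geom_rep_gen i v : rep (s i) v = refl C (alpha i) v.
Proof. by have := geom_rep_word [:: i] v; rewrite /word_prod big_seq1. Qed.

Lemma geom_repK x : cancel (rep x) (rep x^-1%g).
Proof. by move=> v; rewrite -geom_repM mulVg geom_rep1. Qed.

Lemma geom_repVK x : cancel (rep x^-1%g) (rep x).
Proof. by move=> v; rewrite -geom_repM mulgV geom_rep1. Qed.

Definition nneg v := forall i, 0 <= v 0 i.

Lemma nnegD u v : nneg u -> nneg v -> nneg (u + v).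
Proof. by move=> u0 v0 i; rewrite mxE addr_ge0. Qed.

Lemma nneg_sum I (r : seq I) (F : I -> 'rV[R]_n) :
  (forall t, nneg (F t)) -> nneg (\sum_(x <- r) F x).
Proof. by move=> F0 i; rewrite summxE sumr_ge0 // => t _; apply: F0. Qed.

Lemma nneg_anti v : nneg v -> nneg (- v) -> v = 0.
Proof.
move=> v0 vN; apply/rowP => i; apply/eqP; rewrite mxE eq_le v0 andbT.
by have := vN i; rewrite mxE oppr_ge0.
Qed.

Lemma nneg_simple i : nneg (alpha i).
Proof. by move=> j; rewrite mxE ler0n. Qed.

(* The descent of [w] along the simple reflections [s i] and [s j] takes place
   inside one coset of the dihedral group they generate, which has at most six
   elements. *)
Lemma geom_rep_nneg w i : (len w < len (w * s i)%g)%N -> nneg (rep w (alpha i)).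
Proof.
have [k] := ubnP (len w); elim: k => // k IH in w i *; rewrite ltnS => wk wi.
have [[|j ws] wsw wsl] := cox_length_word C w.
  by rewrite -wsw /word_prod big_nil geom_rep1; apply: nneg_simple.
case: (lastP (j :: ws)) (isT : (size (j :: ws) > 0)%N) wsw wsl => //
  {j}{}ws j _ wsw wsl.
pose w' := word_prod C ws.
have w'E : w = (w' * s j)%g by rewrite -wsw /word_prod big_rcons.
have := cox_length_le C ws; rewrite -/w' => w'le.
have lw' : (len w = (len w').+1)%N.
  have := cox_length_gen C w' j; rewrite -w'E -wsl size_rcons; lia.
have posw' : nneg (rep w' (alpha j)) by apply: IH; rewrite -?w'E; lia.
case: (simple_pairP j i) => [ji|_ ji jiC|_ ji jiB].
- by move: wi; rewrite w'E ji -mulgA cox_gen2 mulg1 -ji -w'E; lia.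
- rewrite w'E geom_repM geom_rep_gen reflE ipC ji scale0r subr0.
  apply: IH; first by lia.
  have wsE : (w * s i = w' * s i * s j)%g by rewrite w'E -mulgA jiC mulgA.
  have := cox_length_gen C w' i; have := cox_length_gen C (w' * s i)%g j.
  by rewrite -wsE; lia.
rewrite w'E geom_repM geom_rep_gen reflE ipC ji scaleN1r opprK linearD /=.
have [lw'i|lw'i] := cox_length_gen C w' i.
  by apply: nnegD => //; apply: IH; lia.
pose w'' := (w' * s i)%g.
have w''E : w' = (w'' * s i)%g by rewrite -mulgA cox_gen2 mulg1.
rewrite -/w'' in lw'i.
have -> : rep w' (alpha i) + rep w' (alpha j) = rep w'' (alpha j).
  have ri : refl C (alpha i) (alpha i + alpha j) = alpha j.
    rewrite linearD /= refl_self ?simple_root_norm// reflE ji scaleN1r opprK.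
    by rewrite addrA addrAC addNr add0r.
  by rewrite -linearD -[in RHS]ri -geom_rep_gen -geom_repM -w''E.
apply: IH; first by lia.
(* If [s j] shortened [w''] to [w3], then w = w3 s_j s_i s_j = w3 s_i s_j s_i by the braid relation,
   and [s i] would shorten [w]. *)
have [|lw''] := cox_length_gen C w'' j; first by lia.
pose w3 := (w'' * s j)%g.
have w3E : w'' = (w3 * s j)%g by rewrite -mulgA cox_gen2 mulg1.
have wsE' : (w * s i = w3 * s i * s j)%g.
  have -> : w = (w3 * (s j * s i * s j))%g by rewrite !mulgA -w3E -w''E.
  by rewrite jiB -!mulgA cox_gen2 mulg1.
have := cox_length_gen C w3 i; have := cox_length_gen C (w3 * s i)%g j.
by rewrite -/w3 in lw'' *; rewrite -wsE'; lia.
Qed.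

Lemma geom_rep_npos w i :
  (len (w * s i)%g < len w)%N -> nneg (- rep w (alpha i)).
Proof.
move=> wi; have -> : - rep w (alpha i) = rep (w * s i)%g (alpha i).
  by rewrite geom_repM geom_rep_gen refl_self ?simple_root_norm// linearN.
by apply: geom_rep_nneg; rewrite -mulgA cox_gen2 mulg1.
Qed.

(** * Signs, norms and reflections of roots *)

Lemma roots_simple i : roots C (alpha i).
Proof. by exists 1%g, i; rewrite geom_rep1. Qed.

Lemma roots_rep x a : roots C a -> roots C (rep x a).
Proof. by case=> y [i ->]; exists (x * y)%g, i; rewrite geom_repM. Qed.

Lemma roots_norm a : roots C a -> ip a a = 2.
Proof. by case=> y [i ->]; rewrite geom_rep_isom simple_root_norm. Qed.

Lemma roots_neq0 a : roots C a -> a != 0.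
Proof.
move=> /roots_norm aa; apply: contra_eq_neq aa => ->.
by rewrite ip0l eq_sym pnatr_eq0.
Qed.

Lemma roots_sign a : roots C a -> nneg a \/ nneg (- a).
Proof.
case=> w [i ->]; have [e|e] := cox_length_gen C w i.
  by left; apply: geom_rep_nneg; lia.
by right; apply: geom_rep_npos; lia.
Qed.

(** Faithfulness: a nontrivial element makes negative the simple root of the last letter of a
    reduced word, so it does not act as the identity. *)
Lemma geom_rep_inj x y : rep x =1 rep y -> x = y.
Proof.
move=> xy; apply: divg1_eq.
have : rep (x * y^-1)%g =1 id.
  by move=> v; rewrite geom_repM xy -geom_repM mulgV geom_rep1.
move: (x * y^-1)%g => {xy x y}w w1; have [ws] := cox_length_word C w.
case/lastP: ws => [<- _|ws i wsw wsl]; first by rewrite /word_prod big_nil.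
case: (negP (roots_neq0 (roots_simple i))); apply/eqP.
apply: (nneg_anti (nneg_simple i)); rewrite -[alpha i]w1.
apply: geom_rep_npos; rewrite -wsl -wsw /word_prod big_rcons -mulgA cox_gen2 mulg1.
by rewrite size_rcons ltnS cox_length_le.
Qed.

Lemma refl_rep x a v : rep x (refl C a v) = refl C (rep x a) (rep x v).
Proof. by rewrite !reflE linearB linearZ /= geom_rep_isom. Qed.

Lemma root_refl_rep a : roots C a -> rep (root_refl C a) =1 refl C a.
Proof.
move=> [w [i ->]]; rewrite /root_refl.
apply: (@xgetPex _ _ [set t | rep t =1 refl C (rep w (alpha i))]).
exists (w * s i * w^-1)%g => v.
by rewrite !geom_repM geom_rep_gen refl_rep geom_repVK.
Qed.

Lemma roots_refl a b : roots C a -> roots C b -> roots C (refl C a b).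
Proof. by move=> ra rb; rewrite -root_refl_rep//; apply: roots_rep. Qed.

Lemma rootsN a : roots C a -> roots C (- a).
Proof. by move=> ra; rewrite -(refl_self (roots_norm ra)); apply: roots_refl. Qed.

Lemma root_refl_conj x a : roots C a ->
  root_refl C (rep x a) = (x * root_refl C a * x^-1)%g.
Proof.
move=> ra; apply: geom_rep_inj => v.
rewrite root_refl_rep; last exact: roots_rep.
by rewrite !geom_repM root_refl_rep// refl_rep geom_repVK.
Qed.

Lemma root_reflN a : roots C a -> root_refl C (- a) = root_refl C a.
Proof.
move=> ra; apply: geom_rep_inj => v.
by rewrite !root_refl_rep// ?reflN//; apply: rootsN.
Qed.

Lemma root_refl_simple i : root_refl C (alpha i) = s i.
Proof.
apply: geom_rep_inj => v.
by rewrite root_refl_rep ?geom_rep_gen//; apply: roots_simple.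
Qed.

Lemma root_refl2 a : roots C a -> (root_refl C a * root_refl C a = 1)%g.
Proof.
move=> ra; apply: geom_rep_inj => v.
by rewrite geom_repM geom_rep1 !root_refl_rep// reflK// roots_norm.
Qed.

Lemma root_reflV a : roots C a -> ((root_refl C a)^-1 = root_refl C a)%g.
Proof. by move=> ra; rewrite -[LHS]mulg1 -(root_refl2 ra) mulKg. Qed.

(** The reflection changes only coordinate [i]. If the image were negative, the other coordinates of
    [b] would vanish, and norm 2 with a nonnegative coefficient would force [b = alpha i]. *)
Lemma simple_refl_pos i b : pos_roots C b -> b <> alpha i ->
  pos_roots C (refl C (alpha i) b).
Proof.
move=> [rb b0] bi; have rsb := roots_refl (roots_simple i) rb.
split=> //; have [//|sbN] := roots_sign rsb; case: bi.
have bj j : j != i -> b 0 j = 0.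
  move=> ji; apply/eqP; rewrite eq_le b0 andbT.
  by have := sbN j; rewrite !mxE eqxx (negPf ji) mulr0 subr0 oppr_ge0.
have bE : b = b 0 i *: alpha i.
  apply/rowP => j; rewrite !mxE eqxx /=; case: eqVneq => [->|/bj ->].
    by rewrite mulr1.
  by rewrite mulr0.
have : b 0 i = 1.
  have := roots_norm rb; rewrite bE !ipE simple_root_norm !mxE !eqxx mulr1 => e.
  have := b0 i => bi0; nra.
by move=> b1; rewrite bE b1 scale1r.
Qed.

(** Strong exchange: some letter of a word for [x] takes the image of [b] from positive to negative.
    By [simple_refl_pos] that image is the simple root of the letter, and deleting the letter yields
    a word for [x] times the reflection in [b]. *)
Lemma len_refl_lt x b : pos_roots C b -> nneg (- rep x b) ->
  (len (x * root_refl C b)%g < len x)%N.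
Proof.
move=> pb xb; have [ws xE <-] := cox_length_word C x.
suff [ws' <- wsl] : exists2 ws', word_prod C ws' = (x * root_refl C b)%g
                               & (size ws' < size ws)%N.
  exact: leq_ltn_trans (cox_length_le C ws') wsl.
elim: ws x xE xb => [|i ws IH] x xE xb.
  case: (negP (roots_neq0 pb.1)); apply/eqP.
  by apply: (nneg_anti pb.2); move: xb; rewrite -xE /word_prod big_nil geom_rep1.
pose y := word_prod C ws; have xy : x = (s i * y)%g.
  by rewrite -xE /word_prod big_cons.
have [yb|yb] := roots_sign (roots_rep y pb.1); last first.
  have [ws' ws'E lt] := IH y erefl yb.
  by exists (i :: ws') => //; rewrite xy -mulgA -ws'E /word_prod big_cons.
have pyb : pos_roots C (rep y b) by split=> //; apply: roots_rep pb.1.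
have [yi|yi] := EM (rep y b = alpha i); last first.
  have [r pos] := simple_refl_pos pyb yi.
  case: (negP (roots_neq0 r)); apply/eqP; apply: (nneg_anti pos).
  by move: xb; rewrite xy geom_repM geom_rep_gen.
exists ws => //; rewrite xy -root_refl_simple -yi root_refl_conj; last exact: pb.1.
by rewrite mulgVK -mulgA root_refl2 ?mulg1//; apply: pb.1.
Qed.

Lemma len_refl_gt x b : pos_roots C b -> nneg (rep x b) ->
  (len x < len (x * root_refl C b)%g)%N.
Proof.
move=> pb xb; have := @len_refl_lt (x * root_refl C b)%g b pb.
rewrite -mulgA root_refl2 ?mulg1; last exact: pb.1.
apply; rewrite geom_repM root_refl_rep; last exact: pb.1.
rewrite refl_self ?linearN ?opprK//; exact: roots_norm pb.1.
Qed.

End SimplyLaced.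

(** * Increasing reflection paths *)

Section FiniteSimplyLaced.
Variables (R : realType) (n : nat) (W : finGroupType) (C : coxeterSystem n W).
Hypothesis sl : simply_laced C.
Implicit Types (a b v : 'rV[R]_n) (i j k : 'I_n) (x y w : W).
Implicit Types (A : set 'rV[R]_n).

Local Notation ip := (ip C).
Local Notation alpha := (simple_root R).
Local Notation s i := (cox_gen C i).
Local Notation rep := (@geom_rep R n W C).
Local Notation len := (cox_length C).

(* Positive definite and [W]-invariant by averaging; its existence bounds [ip] on
   pairs of roots. *)
Definition inv_ip u v : R := \sum_(g : W) \sum_i rep g u 0 i * rep g v 0 i.

Lemma inv_ipC u v : inv_ip u v = inv_ip v u.
Proof. by apply: eq_bigr => g _; apply: eq_bigr => i _; rewrite mulrC. Qed.

Lemma inv_ip_linear c u v z : inv_ip (c *: u + v) z = c * inv_ip u z + inv_ip v z.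
Proof.
rewrite /inv_ip mulr_sumr -big_split /=; apply: eq_bigr => g _.
rewrite mulr_sumr -big_split /=; apply: eq_bigr => i _.
by rewrite linearP !mxE; ring.
Qed.

Lemma inv_ip_rep x u v : inv_ip (rep x u) (rep x v) = inv_ip u v.
Proof.
rewrite /inv_ip [RHS](reindex_inj (mulIg x)) /=.
by apply: eq_bigr => g _; rewrite !(geom_repM sl).
Qed.

Lemma inv_ip_gt0 v : v != 0 -> 0 < inv_ip v v.
Proof.
move=> v0; have ge0 g : 0 <= \sum_i rep g v 0 i * rep g v 0 i.
  by apply: sumr_ge0 => i _; rewrite -expr2 sqr_ge0.
rewrite /inv_ip (bigD1 1%g)//= ltr_wpDr ?sumr_ge0//.
rewrite lt_def ge0 andbT; apply: contraNneq v0 => /psumr_eq0P e.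
apply/eqP/rowP => i; rewrite mxE; apply/eqP; rewrite -sqrf_eq0 expr2.
have := e _ i isT; rewrite (geom_rep1 sl) => ->// j _.
by rewrite -expr2 sqr_ge0.
Qed.

(** The reflection in [a] preserves [inv_ip] and sends [a] to [- a]; expanding its value on [v]
    gives the proportionality. *)
Lemma inv_ip_root a v : roots C a -> inv_ip v a *+ 2 = ip v a * inv_ip a a.
Proof.
move=> ra; have := inv_ip_rep (root_refl C a) v a.
rewrite !(root_refl_rep sl)// (refl_self (roots_norm ra)) inv_ipC -scaleN1r.
rewrite -[_ *: a]addr0 inv_ip_linear; set z := inv_ip 0 _.
have -> : z = 0.
  have := inv_ip_linear 1 0 0 (refl C a v); rewrite scale1r mul1r addr0 -/z => e.
  by apply: (addrI z); rewrite addr0.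
rewrite inv_ipC reflE -scaleNr [v + _]addrC inv_ip_linear; lra.
Qed.

(** Let p, q, r be the values of [inv_ip] on (a, a), (b, b), (a, b), and let c = [ip a b]. Then 2r =
    cp = cq, so 4r = c(p + q), while positivity on [a - b] says 2r < p + q. *)
Lemma root_ip_lt2 a b : roots C a -> roots C b -> a <> b -> ip a b < 2.
Proof.
move=> ra rb ab; have : 0 < inv_ip (a - b) (a - b).
  by rewrite inv_ip_gt0// subr_eq0; apply/eqP.
have subl u v z : inv_ip (u - v) z = inv_ip u z - inv_ip v z.
  by rewrite addrC -scaleN1r inv_ip_linear mulN1r addrC.
rewrite subl inv_ipC subl (inv_ipC _ (a - b)) subl (inv_ipC b a).
have := inv_ip_root a rb; have := inv_ip_root b ra; rewrite ipC inv_ipC.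
have := inv_ip_gt0 (roots_neq0 ra); have := inv_ip_gt0 (roots_neq0 rb).
move: (inv_ip a a) (inv_ip b b) (inv_ip a b) (ip a b) => p q r c.
move=> q0 p0 e1 e2 pos; clear subl ab ra rb; rewrite ltNge; apply/negP => c2.
have : 0 <= (c - 2) * (p + q) by apply: mulr_ge0; lra.
lra.
Qed.

(** * Integrality of the form on roots *)

Definition int_vec v := forall i, v 0 i \is a Num.int.

Lemma ip_int u v : int_vec u -> int_vec v -> ip u v \is a Num.int.
Proof.
move=> uZ vZ; rewrite [u]row_sum_simple [v]row_sum_simple ip_suml.
apply: rpred_sum => i _; rewrite ipZl ipC ip_suml rpredM//.
apply: rpred_sum => j _; rewrite ipZl rpredM// ipC.
by case: (simple_pairP R sl i j) => [<-|_ ->|_ ->]; rewrite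
  ?simple_root_norm ?rpredN ?rpred0 ?rpred1 ?rpred_nat.
Qed.

Lemma roots_int a : roots C a -> int_vec a.
Proof.
have simple_int i : int_vec (alpha i) by move=> j; rewrite mxE rpred_nat.
case=> w [i ->]; have [ws <- _] := cox_length_word C w.
rewrite (_ : rep _ _ = word_action C ws (alpha i)); last exact: geom_rep_word.
elim: ws => [|j ws IH] //= k.
rewrite reflE !mxE; apply: rpredB; first exact: IH.
by apply: rpredM; [apply: ip_int | rewrite rpred_nat].
Qed.

Lemma root_ip_eq1 a b : roots C a -> roots C b -> a <> b -> 0 < ip a b -> ip a b = 1.
Proof.
move=> ra rb ab; have := root_ip_lt2 ra rb ab.
have /intrP[m ->] := ip_int (roots_int ra) (roots_int rb).
rewrite ltr0z (ltr_int _ m 2) => m2 m0.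
by have -> : m = 1 by lia.
Qed.

Lemma refl_prod_cons a as_ :
  refl_prod C (a :: as_) = (root_refl C a * refl_prod C as_)%g.
Proof. by rewrite /refl_prod big_cons. Qed.

(* [x] is the current vertex; the path is meant to end at the reflection in [a]. *)
Fixpoint refl_path a x (bs : seq 'rV[R]_n) : Prop :=
  if bs is b :: bs' then
    [/\ pos_roots C (rep x b), 0 < ip (rep x b) a
      & refl_path a (x * root_refl C b)%g bs']
  else True.

Lemma refl_path_rcons a x bs b : refl_path a x bs ->
  pos_roots C (rep (x * refl_prod C bs)%g b) ->
  0 < ip (rep (x * refl_prod C bs)%g b) a ->
  refl_path a x (rcons bs b).
Proof.
elim: bs x => [|c bs IH] x /=; first by rewrite /refl_prod big_nil mulg1.
by move=> [? ? p]; rewrite refl_prod_cons mulgA => *; split=> //; apply: IH.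
Qed.

Lemma refl_path_refl a b x bs :
  pos_roots C a -> pos_roots C b -> ip a b = - 1 -> refl_path b x bs ->
  refl_path (a + b) (root_refl C a * x)%g bs.
Proof.
move=> pa pb ab; have ra := pa.1.
elim: bs x => [|c bs IH] x //= [pc cb p]; split; last first.
- by rewrite -mulgA; apply: IH.
- have abE : a + b = rep (root_refl C a) b.
    by rewrite (root_refl_rep sl)// reflE ipC ab scaleN1r opprK addrC.
  by rewrite abE (geom_repM sl) geom_rep_isom.
rewrite (geom_repM sl) (root_refl_rep sl)//; set d := rep x c in pc cb *.
have rd : roots C (refl C a d) by apply: (roots_refl sl) => //; apply: pc.1.
have [da|da] := ltrP 0 (ip d a); last first.
  split=> // i; rewrite reflE -scaleNr !mxE addr_ge0 ?(pc.2 i)//.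
  by rewrite mulr_ge0 ?oppr_ge0 ?(pa.2 i).
have {}da : ip d a = 1.
  apply: root_ip_eq1 pa.1 _ da; first exact: pc.1.
  by move=> dE; move: cb; rewrite dE ab ltr0N1.
have [->//|db] := EM (refl C a d = b).
have := root_ip_eq1 rd pb.1 db; rewrite reflE da !ipE ab; lra.
Qed.

End FiniteSimplyLaced.

(** * Inversion sets and the weak order *)

Section WeakJoin.
Variables (R : realType) (n : nat) (W : finGroupType) (C : coxeterSystem n W).
Hypothesis sl : simply_laced C.
Implicit Types (a b : 'rV[R]_n) (i j k : 'I_n) (u v w x y z : W).
Implicit Types (A : set 'rV[R]_n).

Local Notation ip := (ip C).
Local Notation alpha := (simple_root R).
Local Notation s i := (cox_gen C i).
Local Notation rep := (@geom_rep R n W C).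
Local Notation len := (cox_length C).
Local Notation inv := (inversion_set R C).

Lemma refl_path_sum A (as_ : seq 'rV[R]_n) :
  A `<=` pos_roots C -> (forall b, b \in as_ -> A b) ->
  roots C (\sum_(b <- as_) b) ->
  exists bs : seq 'rV[R]_n,
    [/\ forall b, b \in bs -> A b,
        root_refl C (\sum_(b <- as_) b) = refl_prod C bs
      & refl_path C (\sum_(b <- as_) b) 1%g bs].
Proof.
move=> Apos; have [m] := ubnP (size as_); elim: m => // m IH in as_ *.
rewrite ltnS => asm asA; set a := \sum_(b <- as_) b => ra.
(* The pairings of the summands with [a] add up to the norm 2 of [a]. *)
have /hasP[c cas ca] : has (fun b => 0 < ip b a) as_.
  apply: contraT => /hasPn np; have := roots_norm ra; rewrite {1}/a ip_suml => e.
  have : \sum_(b <- as_) ip b a <= 0.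
    by rewrite big_seq sumr_le0// => b /np; rewrite -leNgt.
  by rewrite e; lra.
have pc : pos_roots C c by apply/Apos/asA.
have rc := pc.1.
have [caE|nca] := EM (c = a).
  exists [:: c]; split; first by move=> b; rewrite inE => /eqP ->; apply: asA.
  - by rewrite refl_prod_cons /refl_prod big_nil mulg1 caE.
  - by rewrite /= (geom_rep1 sl) caE roots_norm//; split; rewrite -?caE.
have {}ca : ip c a = 1 by apply: root_ip_eq1 => //.
have aE : a = c + \sum_(b <- rem c as_) b by rewrite /a (big_rem c).
set b := \sum_(b <- _) b in aE.
have remA d : d \in rem c as_ -> A d by move/mem_rem; apply: asA.
have bE : b = refl C c a by rewrite reflE ipC ca scale1r aE addrC addKr.
have rb : roots C b by rewrite bE; apply: (roots_refl sl).
have pb : pos_roots C b.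
  split=> // i; rewrite /b summxE big_seq sumr_ge0// => d /remA /Apos [_]; exact.
have cb : ip c b = - 1.
  by rewrite bE reflE !ipE (ipC _ a c) ca (roots_norm pc.1); ring.
have [|bs [bsA bsE bsp]] := IH _ _ remA rb.
  by rewrite size_rem//; case: (as_) cas asm.
have tE : root_refl C a = (root_refl C c * root_refl C b * root_refl C c)%g.
  have -> : a = rep (root_refl C c) b.
    by rewrite (root_refl_rep sl) ?bE ?reflK ?roots_norm//.
  by rewrite (root_refl_conj sl)// (root_reflV sl).
(* The path follows s_a = s_c s_b s_c: an edge labelled [c], the path of [b] translated by s_c, and
   a second edge labelled [c]. *)
exists (c :: rcons bs c); split.
- move=> d; rewrite inE mem_rcons inE orbA orbb => /orP[/eqP ->|/bsA//].
  exact: asA.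
- rewrite refl_prod_cons /refl_prod big_rcons /= -/(refl_prod C bs) -bsE tE.
  by rewrite mulgA.
(* The root of the last edge: s_b c = b + c, and s_c takes this to [b]. *)
have lab : rep (1 * root_refl C c * refl_prod C bs)%g c = b.
  rewrite mul1g -bsE (geom_repM sl) !(root_refl_rep sl)//.
  rewrite [refl C b c]reflE cb scaleN1r opprK reflE ipDl (roots_norm rc) ipC cb.
  by apply/rowP => i; rewrite !mxE; ring.
rewrite /= (geom_rep1 sl) ca; split=> //.
apply: refl_path_rcons; rewrite ?lab//.
  by rewrite mul1g -[root_refl _ _]mulg1 aE; apply: refl_path_refl.
by rewrite aE ipDr ipC cb (roots_norm rb); lra.
Qed.

Lemma refl_path_len a x bs : (forall b, b \in bs -> pos_roots C b) ->
  refl_path C a x bs -> forall m, (m < size bs)%N ->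
  (len (x * refl_prod C (take m bs))%g < len (x * refl_prod C (take m.+1 bs))%g)%N.
Proof.
elim: bs x => [//|b bs IH] x bsp /= [xb _ p] [_|m mb].
  rewrite /= !take0 refl_prod_cons /refl_prod !big_nil !mulg1.
  by apply: (len_refl_gt sl _ xb.2); apply: bsp; rewrite mem_head.
rewrite !refl_prod_cons !mulgA; apply: IH => // c cbs.
by apply: bsp; rewrite inE cbs orbT.
Qed.

Definition nat_span A a := exists2 as_ : seq 'rV[R]_n,
  forall b, b \in as_ -> A b & a = \sum_(b <- as_) b.

Lemma bruhat_preclosure_nat_span A : A `<=` pos_roots C ->
  pos_roots C `&` nat_span A `<=` bruhat_preclosure C A.
Proof.
move=> Apos a [pa [as_ asA aE]]; split=> //.
have [|bs [bsA bsE bsp]] := refl_path_sum Apos asA; first by rewrite -aE; case: pa.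
exists bs; split=> //; first by rewrite aE.
move=> k kb; rewrite -[refl_prod _ _]mul1g -[X in (_ < len X)%N]mul1g.
by apply: refl_path_len bsp k kb => b /bsA; apply: Apos.
Qed.

(** * Inversion sets and length *)

Lemma inversion_setP w a : inv w a <-> pos_roots C a /\ nneg (- rep w^-1%g a).
Proof.
split=> [[pa [b [c [_ c0] <-] ca]]|[pa wa]].
  by split=> //; rewrite -ca (geom_repK sl) opprK.
split=> //; exists (rep w^-1%g a); last exact: geom_repVK.
exists (- rep w^-1%g a); rewrite ?opprK//; split=> //.
by apply: (rootsN sl); apply: (roots_rep sl); case: pa.
Qed.

(** Left multiplication of [w] by s_a is right multiplication by the reflection in [b], so the sign
    of [b] decides whether the length drops. *)
Lemma len_mul_refl w a : pos_roots C a ->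
  (len (root_refl C a * w)%g < len w)%N <-> inv w a.
Proof.
move=> pa; set b := rep w^-1%g a.
have rb : roots C b by apply: (roots_rep sl); case: pa.
have tE : (root_refl C a * w = w * root_refl C b)%g.
  by rewrite (root_refl_conj sl) ?invgK ?mulgA ?mulgV ?mul1g//; case: pa.
have wb : rep w b = a by rewrite geom_repVK.
rewrite tE inversion_setP -/b; split=> [lt|[_ bN]].
  split=> //; have [b0|//] := roots_sign sl rb.
  have := @len_refl_gt _ _ _ _ sl w b (conj rb b0); rewrite wb => /(_ pa.2).
  by rewrite ltnNge ltnW.
rewrite -(root_reflN sl)//; apply: len_refl_lt => //.
  by split=> //; apply: rootsN.
by rewrite linearN /= opprK wb; case: pa.
Qed.

(** With c = - w^-1 b, a positive root, x s_b w = x w s_c. The increase from x to x s_b means that x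
    b is positive, so x w c = - x b is negative and s_c shortens x w. *)
Lemma len_mul_refl_lt x w b : inv w b ->
  (len x < len (x * root_refl C b)%g)%N ->
  (len (x * root_refl C b * w)%g < len (x * w)%g)%N.
Proof.
move=> /inversion_setP[pb wb] lt; have rb := pb.1.
have pc : pos_roots C (- rep w^-1%g b).
  by split=> //; apply/(rootsN sl)/(roots_rep sl).
have -> : (x * root_refl C b * w = x * w * root_refl C (- rep w^-1 b)%R)%g.
  rewrite (root_reflN sl) ?(root_refl_conj sl) ?invgK//; last exact: roots_rep.
  by rewrite !mulgA mulgK.
apply: len_refl_lt => //; rewrite (geom_repM sl) !linearN /= geom_repVK// opprK.
have [//|xb] := roots_sign sl (roots_rep sl x rb).
by have := len_refl_lt sl pb xb; rewrite ltnNge ltnW.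
Qed.

Lemma bruhat_preclosure_sub A w : A `<=` inv w -> bruhat_preclosure C A `<=` inv w.
Proof.
move=> Aw a [pa [as_ [asA asE asl]]]; apply/len_mul_refl => //; rewrite asE.
have step m : (m < size as_)%N ->
  (len (refl_prod C (take m.+1 as_) * w)%g < len (refl_prod C (take m as_) * w)%g)%N.
  move=> mlt; have := asl m mlt; rewrite (take_nth 0 mlt) /refl_prod big_rcons /=.
  by apply: len_mul_refl_lt; apply/Aw/asA/mem_nth.
have lt m : (m < size as_)%N -> (len (refl_prod C (take m.+1 as_) * w)%g < len w)%N.
  elim: m => [|m IH] mlt.
    by have := step 0%N mlt; rewrite take0 {2}/refl_prod big_nil mul1g.
  by apply: ltn_trans (step _ mlt) (IH _); apply: ltnW.
case: (posnP (size as_)) => [/size0nil as0|as_gt0]; last first.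
  by rewrite -[X in refl_prod C X]take_size -(prednK as_gt0) lt// prednK.
(* An empty [as_] would make the reflection in [a] trivial, although it sends [a] to [- a]. *)
have := root_refl_rep sl pa.1 a; rewrite asE as0 /refl_prod big_nil.
rewrite (geom_rep1 sl) (refl_self (roots_norm pa.1)) => aN.
case: (negP (roots_neq0 pa.1)); apply/eqP; apply: (nneg_anti pa.2).
by rewrite -aN; case: pa.
Qed.

Lemma pos_roots_simple i : pos_roots C (alpha i).
Proof. by split; [apply: roots_simple | apply: nneg_simple]. Qed.

Lemma inv_gen_simple w i : inv (s i * w)%g (alpha i) <-> ~ inv w (alpha i).
Proof.
have wi : rep (s i * w)^-1%g (alpha i) = - rep w^-1%g (alpha i).
  rewrite invgM cox_genV (geom_repM sl) (geom_rep_gen sl).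
  rewrite refl_self ?simple_root_norm//; exact: linearN.
rewrite !inversion_setP wi opprK; split=> [[_ wi0] [_ wiN]|wiN].
  have r := roots_rep sl w^-1%g (roots_simple R sl i).
  by case: (negP (roots_neq0 r)); apply/eqP; apply: nneg_anti.
split; first exact: pos_roots_simple.
have [//|wi0] := roots_sign sl (roots_rep sl w^-1%g (roots_simple R sl i)).
by case: wiN; split=> //; apply: pos_roots_simple.
Qed.

Lemma inv_gen_refl w i a : pos_roots C a -> a <> alpha i ->
  inv (s i * w)%g a <-> inv w (refl C (alpha i) a).
Proof.
move=> pa ai; rewrite !inversion_setP invgM cox_genV (geom_repM sl) (geom_rep_gen sl).
split=> [[_ wN]|[_ wN]]; split=> //.
exact: simple_refl_pos.
Qed.

(** Positivity of a root and negativity of its image under w^-1 both pass to sums. *)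
Lemma inv_nat_span w A a : A `<=` inv w -> roots C a -> nat_span A a -> inv w a.
Proof.
move=> Aw ra [as_ asA aE]; apply/inversion_setP; split; [split=> // i|move=> i].
  rewrite aE summxE big_seq sumr_ge0// => b.
  move=> /asA /Aw /inversion_setP[[_ b0] _]; apply: b0.
rewrite aE linear_sum -sumrN summxE big_seq sumr_ge0// => b.
by move=> /asA /Aw /inversion_setP[_]; apply.
Qed.

Lemma nat_span_sub A : A `<=` nat_span A.
Proof.
move=> a Aa; exists [:: a]; rewrite ?big_seq1//.
by move=> b; rewrite inE => /eqP ->.
Qed.

Lemma nat_spanD A a b : nat_span A a -> nat_span A b -> nat_span A (a + b).
Proof.
move=> [as_ asA ->] [bs bsA ->]; exists (as_ ++ bs); rewrite ?big_cat//.
by move=> c; rewrite mem_cat => /orP[/asA|/bsA].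
Qed.

Lemma nat_span0 A : nat_span A 0.
Proof. by exists [::]; rewrite ?big_nil. Qed.

Lemma nat_span_linear A B (f : {linear 'rV[R]_n -> 'rV[R]_n}) a :
  (forall b, A b -> nat_span B (f b)) -> nat_span A a -> nat_span B (f a).
Proof.
move=> AB [as_ asA ->]; rewrite linear_sum big_seq.
apply: (big_ind (nat_span B)); [exact: nat_span0|exact: nat_spanD|].
by move=> b /asA /AB.
Qed.

Lemma nat_span_trans A B : A `<=` nat_span B -> nat_span A `<=` nat_span B.
Proof. by move=> AB a; apply: (@nat_span_linear _ _ idfun). Qed.

(** The third clause implies leastness: by [inv_nat_span], the inversion set of any common upper
    bound contains every root that is a sum of inversions of [u] and [w]. *)
Definition spanned_join u w v :=
  [/\ inv u `<=` inv v, inv w `<=` inv v & inv v `<=` nat_span (inv u `|` inv w)].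

Lemma inv_simpleF w i b : inv (s i * w)%g b -> inv w (alpha i) -> b <> alpha i.
Proof. by move=> wb wi bi; move: wb; rewrite bi => /inv_gen_simple; apply. Qed.

(** Apart from [alpha i], the inversions of [u] are carried by s_i to inversions of [s i * u], hence
    of [w]; [alpha i] itself is an inversion of [s i * w] by the first hypothesis. *)
Lemma inv_gen_mono i u w : ~ inv w (alpha i) -> inv (s i * u)%g `<=` inv w ->
  inv u `<=` inv (s i * w)%g.
Proof.
move=> wi uw a ua.
have [->|ai] := EM (a = alpha i); first exact/inv_gen_simple.
have pa : pos_roots C a by case: ua.
apply/inv_gen_refl => //; apply: uw; apply/inv_gen_refl.
- exact: simple_refl_pos.
- move=> /(congr1 (refl C (alpha i))).
  rewrite reflK ?simple_root_norm// refl_self ?simple_root_norm// => aN.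
  case: (negP (roots_neq0 pa.1)); apply/eqP; apply: nneg_anti pa.2 _.
  by rewrite aN opprK; apply: nneg_simple.
by rewrite reflK ?simple_root_norm.
Qed.

(** Restores a common left descent that was divided out. Applying s_i to a sum of inversions of
    [s i * u] and [s i * w] gives a sum of inversions of [u] and [w], because no summand is
    [alpha i]. *)
Lemma spanned_join_gen i u w v :
  inv u (alpha i) -> inv w (alpha i) ->
  ~ inv v (alpha i) -> spanned_join (s i * u)%g (s i * w)%g v ->
  spanned_join u w (s i * v)%g.
Proof.
move=> ui wi vi [uv wv vuw]; split; [exact: inv_gen_mono|exact: inv_gen_mono|].
move=> a sva; have pa : pos_roots C a by case: sva.
have [->|ai] := EM (a = alpha i); first by apply: nat_span_sub; left.
move: sva => /(inv_gen_refl _ pa ai) /vuw.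
rewrite -{2}[a](reflK (simple_root_norm R C i)); apply: nat_span_linear => b.
move=> ub; apply: nat_span_sub; have pb : pos_roots C b by case: ub => -[].
by case: ub => xb; [left|right]; apply/inv_gen_refl => //; apply: inv_simpleF xb _.
Qed.

Lemma inv1 a : ~ inv 1%g a.
Proof.
move=> /inversion_setP[pa]; rewrite invg1 (geom_rep1 sl) => aN.
by case: (negP (roots_neq0 pa.1)); apply/eqP; apply: nneg_anti pa.2 _.
Qed.

Lemma inv_neq1 w : w <> 1%g -> exists i, inv w (alpha i).
Proof.
have [[|i ws]] := cox_length_word C w; first by rewrite /word_prod big_nil => <- _ [].
move=> wE wl _; exists i; apply/len_mul_refl; first exact: pos_roots_simple.
rewrite root_refl_simple// -wl -wE /word_prod big_cons mulgA cox_gen2 mul1g.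
by rewrite ltnS cox_length_le.
Qed.

Lemma inv_genE i w a : inv (s i * w)%g a -> a = alpha i \/ inv w (refl C (alpha i) a).
Proof.
have [->|ai wa] := EM (a = alpha i); [by left|right].
by apply/inv_gen_refl => //; case: wa.
Qed.

Lemma inv_gen i a : inv (s i) a -> a = alpha i.
Proof. by rewrite -[s i]mulg1 => /inv_genE[//|/inv1]. Qed.

(** [p] is the longest element of the subgroup generated by [s i] and [s j]. Its inversions are the
    two simple roots and, in the braid case, also their sum. *)
Lemma inv_simple_pair i j : i != j -> exists p,
  [/\ inv p (alpha i), inv p (alpha j)
    & inv p `<=` nat_span [set b | b = alpha i \/ b = alpha j]].
Proof.
move=> ij; have aij : alpha i <> alpha j.
  move=> /rowP/(_ i); rewrite !mxE !eqxx (negPf ij) => /eqP.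
  by rewrite oner_eq0.
have aji : alpha j <> alpha i by move=> /esym.
have ni := simple_root_norm R C i; have nj := simple_root_norm R C j.
set B := [set b | _]; have Bi : nat_span B (alpha i) by apply: nat_span_sub; left.
have Bj : nat_span B (alpha j) by apply: nat_span_sub; right.
have reflP k a b : refl C (alpha k) a = b -> a = refl C (alpha k) b.
  by move=> <-; rewrite reflK ?simple_root_norm.
case: (simple_pairP R sl i j) => [ij'|_ ij0 ijC|_ ij1 ijB].
- by rewrite ij' eqxx in ij.
- exists (s i * s j)%g; split.
  + by apply/inv_gen_simple => /inv_gen.
  + by rewrite ijC; apply/inv_gen_simple => /inv_gen.
  move=> a /inv_genE[->//|/inv_gen/reflP->].
  by rewrite reflE ipC ij0 scale0r subr0.
have rij : refl C (alpha i) (alpha j) = alpha i + alpha j.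
  by rewrite reflE ipC ij1 scaleN1r opprK addrC.
have rji : refl C (alpha j) (alpha i) = alpha i + alpha j.
  by rewrite reflE ij1 scaleN1r opprK.
have sum_neq k l : alpha k + alpha l <> alpha k.
  rewrite -[RHS]addr0 => /addrI l0.
  by have := roots_neq0 (roots_simple R sl l); rewrite l0 eqxx.
exists (s i * s j * s i)%g; split.
- rewrite -mulgA; apply/inv_gen_simple => /inv_genE[//|].
  by rewrite rji => /inv_gen; apply: sum_neq.
- rewrite ijB -mulgA; apply/inv_gen_simple => /inv_genE[//|].
  by rewrite rij => /inv_gen; rewrite addrC; apply: sum_neq.
move=> a; rewrite -mulgA.
move=> /inv_genE[->//|/inv_genE[/reflP->|/inv_gen/reflP/reflP->]].
  by rewrite rij; apply: nat_spanD.
by rewrite rji linearD /= refl_self// rij addrA addNr add0r.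
Qed.

(* Induction on the length of an upper bound [z].  If [u] and [w] have a common
   left descent it can be divided out of [u], [w] and [z]; otherwise descents [i]
   of [u] and [j] of [w] give the join [p] of [s i] and [s j], and the pairs
   [(p, w)] and then [(u, p \/ w)] have a common descent. *)
Lemma spanned_join_exists z u w : inv u `<=` inv z -> inv w `<=` inv z ->
  exists v, spanned_join u w v.
Proof.
have [m] := ubnP (len z); elim: m => // m IH in z u w *; rewrite ltnS => zm.
have common i x y : inv x (alpha i) -> inv y (alpha i) ->
    inv x `<=` inv z -> inv y `<=` inv z -> exists v, spanned_join x y v.
  move=> xi yi xz yz; have zi := xz _ xi.
  have div t : inv t (alpha i) -> inv t `<=` inv z ->
      inv (s i * t)%g `<=` inv (s i * z)%g.
    move=> ti tz b tb; have bi := inv_simpleF tb ti.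
    have pb : pos_roots C b by case: tb.
    by apply/inv_gen_refl => //; apply: tz; apply/inv_gen_refl.
  have szm : (len (s i * z)%g < m)%N.
    apply: leq_trans zm; rewrite -(root_refl_simple R sl).
    by apply/len_mul_refl => //; apply: pos_roots_simple.
  have [v vP] := IH _ _ _ szm (div _ xi xz) (div _ yi yz).
  exists (s i * v)%g; apply: spanned_join_gen => // vi.
  (* If [alpha i] were an inversion of [v], it would be a sum of inversions of [s i * z], hence
     itself one, but it is an inversion of [z]. *)
  have [_ _ /(_ _ vi) vs] := vP.
  have : inv (s i * z)%g (alpha i).
    apply: inv_nat_span vs; last exact: roots_simple.
    by move=> b [] /div; apply.
  by move/inv_gen_simple; apply.
move=> uz wz; have [->|/inv_neq1[i ui]] := EM (u = 1%g).
  exists w; split=> //; first by move=> a /inv1.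
  by move=> a wa; apply: nat_span_sub; right.
have [->|/inv_neq1[j wj]] := EM (w = 1%g).
  exists u; split=> //; first by move=> a /inv1.
  by move=> a ua; apply: nat_span_sub; left.
have [ij|ij] := eqVneq i j; first by apply: (common i) => //; rewrite ij.
have [p [pi pj pij]] := inv_simple_pair ij.
have zB : [set b | b = alpha i \/ b = alpha j] `<=` inv z.
  by move=> b [->|->]; [apply: uz|apply: wz].
have pz : inv p `<=` inv z.
  move=> a pa; have [ra _] : pos_roots C a by case: pa.
  by apply: inv_nat_span zB ra (pij _ pa).
have [v [pv wv vpw]] := common j p w pj wj pz wz.
have vz : inv v `<=` inv z.
  move=> a va; have [ra _] : pos_roots C a by case: va.
  by apply: inv_nat_span ra (vpw _ va) => b [/pz|/wz].
have [v' [uv' vv' vuv]] := common i u v ui (pv _ pi) uz vz.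
exists v'; split=> //; first by move=> a /wv /vv'.
have uw_ij : [set b | b = alpha i \/ b = alpha j] `<=` nat_span (inv u `|` inv w).
  by move=> b [->|->]; apply: nat_span_sub; [left|right].
move=> a /vuv; apply: nat_span_trans => b [ub|/vpw].
  by apply: nat_span_sub; left.
apply: nat_span_trans => {}b [/pij|wb]; last by apply: nat_span_sub; right.
exact: nat_span_trans.
Qed.

(** For [z] of maximal length every simple root is an inversion; positive roots are nonnegative
    combinations of simple roots, so they are inversions too. *)
Lemma inv_longest : exists z, inv z = pos_roots C.
Proof.
case: (arg_maxnP (fun x : W => len x) (isT : predT (1%g : W))) => z _ zmax.
have zi i : inv z (alpha i).
  apply/len_mul_refl; first exact: pos_roots_simple.
  have le_z : (len (s i * z)%g <= len z)%N by apply: zmax.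
  rewrite root_refl_simple// ltn_neqAle le_z andbT; apply/eqP => e.
  (* Equal lengths of [s i * z] and [z] contradict the sign character. *)
  have [h hE] := cox_parity C.
  have [ws zE zl] := cox_length_word C z.
  have [ws' szE szl] := cox_length_word C (s i * z)%g.
  have := hE ws'; rewrite szl e -zl -hE szE -{1}zE.
  have -> : (s i * word_prod C ws = word_prod C (i :: ws))%g.
    by rewrite /word_prod big_cons.
  by rewrite !hE /=; case: odd.
exists z; apply/seteqP; split=> a; first by case.
move=> pa; apply/inversion_setP; split=> //; rewrite {1}[a]row_sum_simple.
rewrite linear_sum -sumrN /=; apply: nneg_sum => i k.
rewrite linearZ /= -scalerN mxE mulr_ge0 ?(pa.2 i)//.
by have /inversion_setP[_ ->] := zi i.
Qed.

End WeakJoin.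

Theorem theorem1p2 (R : realType) (n : nat) (W : finGroupType)
    (C : coxeterSystem n W) (C_simply_laced : simply_laced C) (u w : W) :
  inversion_set R C (weak_join R C u w) =
  bruhat_preclosure C (inversion_set R C u `|` inversion_set R C w).
Proof.
set A := _ `|` _; have sl := C_simply_laced.
have Apos : A `<=` pos_roots C by move=> a [] [].
have [z zE] := inv_longest R sl.
have [|| v [uv wv vA]] := @spanned_join_exists R n W C sl z u w.
- by rewrite zE => a [].
- by rewrite zE => a [].
have v_least x : weak_le R C u x -> weak_le R C w x -> weak_le R C v x.
  move=> ux wx a va; have [ra _] : pos_roots C a by case: va.
  by apply: inv_nat_span ra (vA _ va) => // b [/ux|/wx].
(* [v] witnesses that a join exists, so the element picked by [xget] is a join and not a mere
   default. *)
have [uj wj j_least] : is_weak_join R C u w (weak_join R C u w).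
  by apply: (@xgetI _ _ [set x | is_weak_join R C u w x] v).
apply/seteqP; split; last by apply: bruhat_preclosure_sub => // a [/uj|/wj].
(* The chosen join lies below [v], so its inversions are sums of elements of [A]. *)
move=> a /(j_least _ uv wv) va; apply: bruhat_preclosure_nat_span => //.
by split; [case: va | exact: vA].
Qed.
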